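(* Let $k\geq 2$ be an integer and let $S$ be a spider of order $2k+3$ with $r$ odd legs and $s$ legs of length $1$. If $r\geq 3$ and $2s-r\geq 2$, then for all sufficiently large $n$, every graph $G$ of order $n$ with $\mu(G)\geq \mu(S_{n,k})$ contains $S$ as a subgraph.
   Context: All graphs are finite, simple and undirected. The order of a graph is its number of vertices. $\mu(G)$ denotes the spectral radius of $G$, i.e. the largest eigenvalue of its adjacency matrix. ''Contains as a subgraph'' means a not necessarily induced subgraph (up to isomorphism). $S_{n,k}=K_k\vee\overline{K_{n-k}}$ is the graph of order $n$ obtained by joining every vertex of a complete graph $K_k$ to every vertex of an independent set of order $n-k$. A spider is a tree with at most one vertex of degree more than $2$; that vertex is called the center (if there is no such vertex, so the spider is a path, any designated vertex can act as the center). A leg of a spider is a path from the center to a vertex of degree $1$; the length of a leg is its number of edges; an odd leg is a leg of odd length (so legs of length $1$ are counted among the odd legs). ''Sufficiently large $n$'' means $n\ge n_0$ for some threshold $n_0$ depending only on $k$ and $S$. *)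

(* Defs.v *)
From mathcomp Require Import all_boot all_order all_algebra.
From mathcomp Require Import classical_sets reals.

Set Implicit Arguments.
Unset Strict Implicit.
Unset Printing Implicit Defensive.

Import Order.TTheory GRing.Theory Num.Theory.

Record sgraph := SGraph {
  vertex :> finType;
  adj : rel vertex;
  adj_sym : symmetric adj;
  adj_irr : irreflexive adj }.

Definition degree (G : sgraph) (v : G) : nat := #|[set w : G | adj v w]|.

Definition contains_subgraph (G H : sgraph) : Prop :=
  exists f : H -> G, injective f /\ forall x y : H, adj x y -> adj (f x) (f y).

Section Constructions.

Definition complete_adj (n : nat) : rel 'I_n := fun i j => i != j.

Fact complete_sym n : symmetric (@complete_adj n).
Proof. by move=> i j; rewrite /complete_adj eq_sym. Qed.

Fact complete_irr n : irreflexive (@complete_adj n).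
Proof. by move=> i; rewrite /complete_adj eqxx. Qed.

Definition complete_graph (n : nat) : sgraph :=
  SGraph (@complete_sym n) (@complete_irr n).

Definition compl_adj (G : sgraph) : rel G := fun x y => (x != y) && ~~ adj x y.

Fact compl_sym G : symmetric (@compl_adj G).
Proof. by move=> x y; rewrite /compl_adj eq_sym adj_sym. Qed.

Fact compl_irr G : irreflexive (@compl_adj G).
Proof. by move=> x; rewrite /compl_adj eqxx. Qed.

Definition compl_graph (G : sgraph) : sgraph :=
  SGraph (@compl_sym G) (@compl_irr G).

Definition join_adj (G H : sgraph) : rel (G + H)%type := fun x y =>
  match x, y with
  | inl a, inl b => adj a b
  | inr a, inr b => adj a b
  | _, _ => true
  end.

Fact join_sym G H : symmetric (@join_adj G H).
Proof. by move=> [a|a] [b|b] //=; apply: adj_sym. Qed.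

Fact join_irr G H : irreflexive (@join_adj G H).
Proof. by move=> [a|a] /=; apply: adj_irr. Qed.

Definition join_graph (G H : sgraph) : sgraph :=
  SGraph (@join_sym G H) (@join_irr G H).

End Constructions.

(* The order is n only when k <= n, because n - k is truncated. *)
Definition S_graph (n k : nat) : sgraph :=
  join_graph (complete_graph k) (compl_graph (complete_graph (n - k))).

Definition adjacency_matrix (R : realType) (G : sgraph) : 'M[R]_#|G| :=
  (\matrix_(i, j) (adj (enum_val i) (enum_val j))%:R)%R.

(* A real symmetric matrix of positive size has finitely many, and at least   *)
(* one, real eigenvalues, so for a nonempty graph this supremum is a maximum. *)
Definition spectral_radius (R : realType) (G : sgraph) : R :=
  sup [set a : R | eigenvalue (adjacency_matrix R G) a]%classic.

(* A list of two adjacent vertices satisfies ucycle, whence the lower bound   *)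
(* on the size.                                                               *)
Definition acyclic (G : sgraph) : Prop :=
  forall p : seq G, 2 < size p -> ~ ucycle (@adj G) p.

Definition tree (G : sgraph) : Prop :=
  [/\ 0 < #|G|, forall x y : G, connect (@adj G) x y & acyclic G].

Definition spider (S : sgraph) : Prop :=
  tree S /\ forall u v : S, 2 < degree u -> 2 < degree v -> u = v.

Definition spider_center (S : sgraph) (c : S) : Prop :=
  2 < degree c \/ forall v : S, degree v <= 2.

(* A leg is represented by its vertices other than c, listed from c outwards, *)
(* so that its length in edges is the size of the list.  The nonemptiness     *)
(* condition matters only when c itself has degree 1.                         *)
Definition legs (S : sgraph) (c : S) : {set {bseq #|S| of S}} :=
  [set p : {bseq #|S| of S} |
    [&& 0 < size p, path (@adj S) c p, uniq (c :: p) &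
        degree (last c p) == 1]].

Definition num_odd_legs (S : sgraph) (c : S) : nat :=
  #|[set p in legs c | odd (size p)]|.

Definition num_unit_legs (S : sgraph) (c : S) : nat :=
  #|[set p in legs c | size p == 1]|.

(* Main.v *)
Require Import Defs.
From mathcomp Require Import all_boot all_order all_algebra.
From mathcomp Require Import boolp classical_sets reals.
From mathcomp Require Import zify ring lra.
(* Imported after classical_sets so that set0, setIidPr and the like speak of
   finite sets. *)
From mathcomp Require Import fintype finset.

(** Root the spider at its center and let [E] be the set of vertices at even
    distance from it.  The parent map sends the noncentral vertices of [E]
    injectively to odd vertices that are not leaves, so the number of odd legs
    is at most [#|~: E| - #|E| + 1]; with at least three odd legs and [2k+3]
    vertices this gives [#|E| <= k] ([spider_even_class]).  Hence the spider is a
    subgraph of the complete bipartite graph with parts of sizes [k] and [m] as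
    soon as [m] is large ([bipartite_in_biclique]), and it suffices to find that
    graph in [G].

    Suppose that [G] does not contain the spider.  As for any tree, [G] and all
    its subgraphs then have linearly many edges ([tree_free_sparse]).  On the
    other hand [G] has an eigenvalue [a] with [a ^ 2 >= k * (n - k)]
    ([large_eigenvector]).  Scale an eigenvector so that its largest entry is
    1, at a vertex [u], and expand [a ^ 2 * x u] as the sum of [x] over the ends
    of the walks of length 2 from [u].  By sparsity the vertices of small weight
    contribute at most [n / 2], while those of larger weight form a set [T] of
    bounded size.  So the neighbours of [u] send at least about [(k - 1/2) * n]
    edges to [T]: linearly many vertices have [k] neighbours in [T], and by the
    pigeonhole principle many of them have [k] neighbours in common
    ([sparse_eigenvector_biclique]).

    Weights are only ever bounded from above, so any eigenvector with a positive
    entry will do. *)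

Set Implicit Arguments.
Unset Strict Implicit.
Unset Printing Implicit Defensive.

Import Order.TTheory GRing.Theory Num.Theory.

(** * Trees *)

(** If two simple paths from [x] to the same vertex differ, then after their
    common prefix they leave some vertex along distinct edges; the first vertex
    of one branch that lies on the other closes a cycle. *)
Lemma acyclic_path_unique (G : sgraph) : acyclic G ->
  forall (x : G) (p q : seq G), path (@adj G) x p -> path (@adj G) x q ->
    uniq (x :: p) -> uniq (x :: q) -> last x p = last x q -> p = q.
Proof.
move=> acG.
have fork (x : G) p q : path (@adj G) x p -> path (@adj G) x q ->
    uniq (x :: p) -> uniq (x :: q) -> has (mem q) p -> head x p != head x q ->
    False.
  move=> + + + + h; case: (split_find h) => z s1 s2 /= zq s1q.
  case/splitPr: zq s1q => t1 t2 s1q.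
  rewrite cat_path rcons_path => /andP[/andP[xs1 s1z] _].
  rewrite cat_path /= => /andP[xt1 /andP[t1z _]].
  rewrite cat_rcons => /andP[]; rewrite mem_cat inE !negb_or.
  move=> /and3P[xs1N xz _]; rewrite cat_uniq => /and3P[us1 zs1 _].
  move=> /andP[]; rewrite mem_cat negb_or => /andP[xt1N _].
  rewrite cat_uniq => /and3P[ut1 zt1 _] neq.
  (* The cycle goes out along the first branch to the meeting vertex [z] and
     comes back along the second; it has length at least 3 because the two
     branches start differently. *)
  apply: (acG (x :: s1 ++ z :: rev t1)).
    rewrite /= size_cat /= size_rev.
    by case: s1 t1 neq {h s1q xs1 s1z xt1 t1z xs1N us1 zs1 xt1N ut1 zt1}
      => [|? ?] [|? ?] //=; rewrite ?eqxx // => _; lia.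
  have rev_t1 : path (@adj G) z (rcons (rev t1) x).
    have := rev_path (@adj G) x (rcons t1 z).
    rewrite last_rcons belast_rcons rev_cons => ->.
    rewrite (@eq_path _ _ (@adj G)) ?rcons_path ?xt1 // => y y'.
    exact: adj_sym.
  apply/andP; split.
    by rewrite /= rcons_cat cat_path xs1 /= s1z.
  rewrite /= mem_cat inE mem_rev !negb_or xs1N xz xt1N cat_uniq us1 /= mem_rev.
  move: zs1 zt1; rewrite /= !negb_or => /andP[zs1 _] /andP[zt1 _].
  rewrite zs1 zt1 rev_uniq ut1 !andbT.
  rewrite has_rev /=; apply/hasPn => y yt1; apply: contra s1q => /= ys1.
  by apply/hasP; exists y => //=; rewrite mem_cat yt1.
move=> x p; elim: p x => [|a p IHp] x [|b q] //.
- by move=> _ _ _ /andP[xNq _] /= xE; rewrite {1}xE mem_last in xNq.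
- by move=> _ _ /andP[xNp _] _ /= xE; rewrite -{1}xE mem_last in xNp.
have [<-|neq_ab] := eqVneq a b.
  move=> /andP[_ pp] /andP[_ pq] /andP[_ up] /andP[_ uq] /= e.
  by rewrite (IHp a q).
move=> pp pq up uq lpq; case: (fork x (a :: p) (b :: q)) => //.
apply/hasP; exists (last a p); first exact: mem_last.
by have /= -> := lpq; apply: mem_last.
Qed.

(** Rooting a tree at [c].  The path from [c] to each vertex is unique, so its
    length and its last but one vertex are well defined, and the last clause
    lets the length of any simple path from [c] be read off as a depth. *)
Lemma tree_parent (S : sgraph) (c : S) : tree S ->
  exists (depth : S -> nat) (parent : S -> S),
  [/\ forall v, v != c -> adj (parent v) v /\ depth v = (depth (parent v)).+1,
      forall v w, adj v w -> (w != c /\ parent w = v) \/ (v != c /\ parent v = w)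
    & forall p, path (@adj S) c p -> uniq (c :: p) -> depth (last c p) = size p].
Proof.
case=> _ conS acS.
have pathP v : exists p, [&& path (@adj S) c p, uniq (c :: p) & last c p == v].
  have /connectP[p pp ->] := conS c v; case: (shortenP pp) => p' pp' up' _.
  by exists p'; rewrite pp' up' eqxx.
pose P v := xchoose (pathP v).
have PP v : [/\ path (@adj S) c (P v), uniq (c :: P v) & last c (P v) = v].
  by have /and3P[? ? /eqP] := xchooseP (pathP v).
have Puniq p : path (@adj S) c p -> uniq (c :: p) -> P (last c p) = p.
  move=> pp up; have [pP uP lP] := PP (last c p).
  exact: (acyclic_path_unique acS pP pp uP up lP).
have Prcons v w : adj v w -> w \notin c :: P v -> P w = rcons (P v) w.
  move=> vw wP; have [pP uP lP] := PP v.
  rewrite -[w in LHS](last_rcons c (P v) w) Puniq ?rcons_path ?pP ?lP //.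
  by rewrite -rcons_cons rcons_uniq wP.
exists (fun v => size (P v)), (fun v => last c (belast c (P v))).
have Pedge v w : adj v w -> w \notin c :: P v ->
    w != c /\ last c (belast c (P w)) = v.
  move=> vw wP; rewrite (Prcons v w vw wP) belast_rcons /=.
  have [_ _ ->] := PP v; split=> //.
  by apply: contraNneq wP => ->; rewrite mem_head.
split.
- move=> v vc; have [pP uP lP] := PP v.
  case/lastP E: (P v) pP uP lP => [|p w].
    by move=> _ _ /= /esym/eqP; rewrite (negPf vc).
  rewrite last_rcons rcons_path belast_rcons => /andP[pp lw] + wv; subst w.
  rewrite -rcons_cons rcons_uniq => /andP[_ up].
  by rewrite /= Puniq // size_rcons.
- move=> v w vw; have [wP|wP] := boolP (w \in c :: P v); last first.
    by left; apply: Pedge.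
  right; apply: Pedge; first by rewrite adj_sym.
  have [pP uP lP] := PP v.
  have neq : v != w by apply: contraTneq vw => ->; rewrite adj_irr.
  apply/negP => vPw; case/splitPl: wP pP uP lP => p1 p2 lp1.
  rewrite cat_path -cat_cons cat_uniq last_cat lp1.
  move=> /andP[pp1 _] /and3P[up1 /hasPn dis _] lp2.
  have Pw : P w = p1 by rewrite -lp1 Puniq.
  move: vPw; rewrite Pw -lp2; case: p2 lp2 dis => [|y p2] /= lp2 dis.
    by move: neq; rewrite -lp2 eqxx.
  by apply/negP/dis/mem_last.
- by move=> p pp up; rewrite Puniq.
Qed.

Lemma size_uniq_le_card (T : finType) (s : seq T) (A : {set T}) :
  uniq s -> {subset s <= A} -> size s <= #|A|.
Proof.
by move=> us sA; rewrite cardE uniq_leq_size // => x /sA; rewrite mem_enum.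
Qed.

(** The vertices at even distance from the center are few when there are many
    odd legs.  Every even vertex other than the center has an odd parent, which
    has degree at least 2 because its own parent is a further neighbour;
    as an odd vertex has degree at most 2 it has at most one child, so the
    parent map is injective.  It avoids the ends of the odd legs, which are odd
    leaves. *)
Lemma spider_even_class (S : sgraph) (c : S) :
  spider S -> spider_center c ->
  exists E : {set S}, (forall v w, adj v w -> (v \in E) = (w \notin E))
    /\ 2 * #|E| + num_odd_legs c <= #|S|.+1.
Proof.
move=> [treeS deg3] centerc.
have [depth [parent [parentP edgeP depthP]]] := tree_parent c treeS.
have depthc : depth c = 0 by rewrite (depthP [::]).
have depthE v w : adj v w -> odd (depth v) = ~~ odd (depth w).
  by case/edgeP=> -[/parentP[_ /= dE] pE]; rewrite dE pE /= ?negbK.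
exists [set v | ~~ odd (depth v)]; split=> [v w /depthE|].
  by rewrite !inE negbK => ->; rewrite negbK.
set E := [set v | _].
have deg2 v : v != c -> degree v <= 2.
  rewrite leqNgt => vc; apply/negP => v3; case: centerc => [c3|le2].
    by rewrite (deg3 v c) ?eqxx in vc.
  by rewrite ltnNge le2 in v3.
have neq_c v : odd (depth v) -> v != c.
  by move=> dv; apply: contraTneq dv => ->; rewrite depthc.
pose L := [set v | odd (depth v) & degree v == 1].
have leL : num_odd_legs c <= #|L|.
  rewrite /num_odd_legs.
  rewrite -(@card_in_imset _ _ (fun p : {bseq #|S| of S} => last c p)).
    apply: subset_leq_card; apply/subsetP => v /imsetP[p]; rewrite !inE.
    by move=> /andP[/and4P[_ pp up lp] op] ->; rewrite depthP ?op.
  move=> p q; rewrite !inE => /andP[/and4P[_ pp up _] _].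
  move=> /andP[/and4P[_ pq uq _] _] e; apply/val_inj.
  by case: treeS => _ _ acS; apply: (acyclic_path_unique acS pp pq up uq e).
have memE v : v \in E :\ c ->
    [/\ v != c, ~~ odd (depth v), odd (depth (parent v)),
        adj (parent v) v & adj (parent v) (parent (parent v))
        /\ depth v = (depth (parent (parent v))).+2].
  rewrite !inE => /andP[vc dv]; have [av dvE] := parentP v vc.
  have dp : odd (depth (parent v)) by move: dv; rewrite dvE /= negbK.
  have [ap dpE] := parentP _ (neq_c _ dp).
  by split=> //; rewrite adj_sym ap -dpE.
have lePar : #|E :\ c| <= #|~: E :\: L|.
  rewrite -(@card_in_imset _ _ parent (mem (E :\ c))).
    apply: subset_leq_card; apply/subsetP => _ /imsetP[v vE ->].
    have [vc dv dp av [app dE]] := memE v vE.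
    rewrite !inE dp /= andbT neq_ltn; apply/orP; right.
    apply: (@size_uniq_le_card _ [:: v; parent (parent v)]).
      rewrite /= inE andbT; apply: contraTneq isT => e.
      by have := congr1 depth e; rewrite dE; lia.
    by move=> w; rewrite !inE => /orP[] /eqP->.
  move=> v w vE wE pE; have [vc dv dp av [app dE]] := memE v vE.
  have [_ _ _ aw [_ dwE]] := memE w wE; apply/eqP/negPn/negP => vw.
  have: size [:: v; w; parent (parent v)] <= degree (parent v).
    apply: size_uniq_le_card.
      rewrite /= !inE !negb_or vw /= andbT; apply/andP; split.
        by apply: contraTneq isT => e; have := congr1 depth e; rewrite dE; lia.
      apply: contraTneq isT => e; have := congr1 depth e.
      by rewrite dwE -pE; lia.
    move=> y; rewrite !inE => /or3P[] /eqP->; rewrite ?app ?av //.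
    by rewrite pE aw.
  by rewrite leqNgt ltnS deg2 ?neq_c.
have LE : L \subset ~: E by apply/subsetP => v; rewrite !inE negbK => /andP[].
have cE : c \in E by rewrite inE depthc.
have := cardsC E; rewrite -(cardsID L (~: E)) (setIidPr LE).
move: lePar; rewrite (cardsD1 c E) cE.
lia.
Qed.

(** * Embedding trees and sparsity *)

Definition nbhd (G : sgraph) (v : G) : {set G} := [set w | adj v w].

(** Greedy embedding: the vertices of the tree are placed in order of depth, so
    that a new vertex only has to be joined to the image of its parent, and the
    minimum degree leaves a free neighbour. *)
Lemma tree_embeds_min_degree (S G : sgraph) (U : {set G}) :
  tree S -> U != set0 -> {in U, forall v, #|S| <= #|nbhd v :&: U|} ->
  contains_subgraph G S.
Proof.
move=> treeS /set0Pn[u0 u0U] degU; have [S0 _ _] := treeS.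
have /card_gt0P[c _] := S0.
have [depth [parent [parentP edgeP _]]] := tree_parent c treeS.
pose partial j := exists (X : {set S}) (f : S -> G),
    [/\ #|X| = j, c \in X, {in X, forall v, f v \in U},
        {in X &, injective f} &
        {in X, forall v, v != c ->
           parent v \in X /\ adj (f (parent v)) (f v)}].
have grow j : 0 < j <= #|S| -> partial j.
  elim: j => [//|j IHj] /andP[_ jS]; have [->|j0] := eqVneq j 0.
    exists [set c], (fun=> u0); rewrite cards1 inE eqxx; split=> //.
      by move=> v w /set1P-> /set1P->.
    by move=> v /set1P->; rewrite eqxx.
  have [X [f [cardX cX fU injf fX]]] : partial j.
    by apply: IHj; rewrite lt0n j0 ltnW.
  have /card_gt0P[y0 y0X] : 0 < #|~: X| by have := cardsC X; lia.
  rewrite inE in y0X.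
  case: (@arg_minnP _ y0 [pred v | v \notin X] depth y0X) => y /= yX miny.
  have yc : y != c by apply: contraNneq yX => ->.
  have [apy dy] := parentP y yc.
  have pyX : parent y \in X.
    apply/negPn/negP => pyX; have := miny (parent y).
    by move=> /(_ pyX); rewrite dy ltnn.
  have /set0Pn[w] : (nbhd (f (parent y)) :&: U) :\: (f @: X) != set0.
    rewrite -card_gt0 cardsD subn_gt0.
    apply: leq_ltn_trans (subset_leq_card (subsetIr _ _)) _.
    rewrite card_in_imset // cardX; apply: leq_trans jS _.
    exact/degU/fU.
  rewrite !inE => /and3P[wX aw wU].
  exists (y |: X), (fun v => if v == y then w else f v).
  have neq v : v \in X -> v == y = false.
    by move=> vX; apply: contraNF yX => /eqP <-.
  split.
  - by rewrite cardsU1 yX cardX.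
  - by rewrite !inE cX orbT.
  - by move=> v /setU1P[->|vX]; rewrite ?eqxx // neq // fU.
  - move=> v1 v2 /setU1P[->|v1X] /setU1P[->|v2X] //; rewrite ?eqxx ?neq //.
    + by move=> e; case/negP: wX; rewrite e imset_f.
    + by move=> e; case/negP: wX; rewrite -e imset_f.
    + exact: injf.
  - move=> v /setU1P[-> _|vX vc]; first by rewrite eqxx neq // !inE pyX orbT.
    by have [pX ap] := fX v vX vc; rewrite !neq // !inE pX orbT.
have [X [f [cardX _ _ injf fX]]] : partial #|S|.
  by apply: grow; rewrite S0 leqnn.
have XT v : v \in X.
  suff -> : X = setT by [].
  by apply/eqP; rewrite eqEcard subsetT cardsT cardX /=.
exists f; split=> [v w|v w]; first exact: injf.
case/edgeP=> -[vc <-]; have [_] := fX _ (XT _) vc => //.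
by rewrite adj_sym.
Qed.

(** The sum counts each edge inside [U] twice. *)
Definition sparse (C : nat) (G : sgraph) : Prop :=
  forall U : {set G}, \sum_(v in U) #|nbhd v :&: U| <= C * #|U|.

(** Without a copy of the tree, every nonempty set of vertices has a vertex with
    fewer than [#|S|] neighbours inside the set; peel such vertices off. *)
Lemma tree_free_sparse (S G : sgraph) :
  tree S -> ~ contains_subgraph G S -> sparse (2 * #|S|) G.
Proof.
move=> treeS freeS U; have [m] := ubnP #|U|; elim: m U => // m IHm U ltU.
have [->|U0] := eqVneq U set0; first by rewrite big_set0.
have [|] := boolP [forall v in U, #|S| <= #|nbhd v :&: U|].
  by move=> /forall_inP /(tree_embeds_min_degree treeS U0).
rewrite negb_forall_in => /exists_inP[v vU]; rewrite -ltnNge => dv.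
have cardU : #|U| = #|U :\ v|.+1 by rewrite (cardsD1 v U) vU.
have ltUv : #|U :\ v| < m by lia.
have := IHm _ ltUv; rewrite (big_setD1 v vU) /= cardU.
suff -> : \sum_(w in U :\ v) #|nbhd w :&: U| =
          \sum_(w in U :\ v) #|nbhd w :&: (U :\ v)| + #|nbhd v :&: U|.
  by rewrite mulnSr addnCA => ?; rewrite leq_add // addnn mul2n leq_double ltnW.
rewrite (eq_bigr (fun w => #|nbhd w :&: (U :\ v)| + adj w v)); last first.
  by move=> w _; rewrite (cardsD1 v (_ :&: U)) -setIDA !inE vU andbT addnC.
rewrite big_split /=; congr (_ + _).
rewrite -sum1_card big_mkcond [RHS]big_mkcond /=.
by apply: eq_bigr => w _; rewrite !inE adj_sym;
   case: eqVneq => [->|_] /=; rewrite ?adj_irr //;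
   case: (w \in U); case: (adj _ _).
Qed.

Lemma sparse_between (C : nat) (G : sgraph) (X Y : {set G}) :
  sparse C G -> \sum_(v in X) #|nbhd v :&: Y| <= C * (#|X| + #|Y|).
Proof.
move=> /(_ (X :|: Y)) le1.
have leU : #|X :|: Y| <= #|X| + #|Y| by rewrite cardsU leq_subr.
apply: (@leq_trans (\sum_(v in X :|: Y) #|nbhd v :&: (X :|: Y)|)); last first.
  by apply: leq_trans le1 _; rewrite leq_mul2l leU orbT.
rewrite [leqRHS](big_setID X) /= setUK; apply: leq_trans (leq_addr _ _).
apply: leq_sum => v _; apply/subset_leq_card/setIS/subsetUr.
Qed.

(** * Embedding bipartite graphs *)

Lemma injection_into (S T : finType) (E : {set S}) (A : {set T}) (t0 : T) :
  #|E| <= #|A| ->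
  exists f : S -> T, {in E &, injective f} /\ {in E, forall v, f v \in A}.
Proof.
move=> leEA; exists (fun v => nth t0 (enum A) (index v (enum E))).
have ltA v : v \in E -> index v (enum E) < size (enum A).
  move=> vE; rewrite -cardE; apply: leq_trans leEA.
  by rewrite cardE index_mem mem_enum.
split=> [v w vE wE /eqP|v vE]; last by rewrite -mem_enum mem_nth ?ltA.
rewrite nth_uniq ?ltA ?enum_uniq // => /eqP e.
by rewrite -[v](nth_index v (s := enum E)) ?mem_enum // e nth_index ?mem_enum.
Qed.

Lemma bipartite_in_biclique (S G : sgraph) (E : {set S}) (A B : {set G}) :
  (forall v w, adj v w -> (v \in E) = (w \notin E)) ->
  {in A & B, forall a b, adj a b} -> #|E| <= #|A| -> #|~: E| <= #|B| ->
  0 < #|B| -> contains_subgraph G S.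
Proof.
move=> bipE adjAB leE leE' /card_gt0P[b0 _].
have [f [injf fA]] := injection_into b0 leE.
have [g [injg gB]] := injection_into b0 leE'.
have fgP v w : v \in E -> w \notin E -> adj (f v) (g w).
  by move=> vE wE; apply: adjAB; rewrite ?fA ?gB // inE.
exists (fun v => if v \in E then f v else g v); split=> v w; last first.
  move/bipE; case: ifPn => vE; case: ifPn => wE // _; first exact: fgP.
  by rewrite adj_sym fgP.
case: ifPn => vE; case: ifPn => wE.
- exact: injf.
- by move=> e; have := fgP v w vE wE; rewrite e adj_irr.
- by move=> e; have := fgP w v wE vE; rewrite e adj_irr.
- by apply: injg; rewrite inE.
Qed.

(** * Eigenvalues of graphs *)

Local Open Scope ring_scope.

Lemma eigenvalue_adjacencyP (R : realType) (G : sgraph) (a : R) :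
  eigenvalue (adjacency_matrix R G) a <->
  exists x : G -> R, (exists v, x v != 0) /\
    forall v, \sum_(w | adj v w) x w = a * x v.
Proof.
have mulE (x : G -> R) v :
    \sum_(i < #|G|) x (enum_val i) * (adj (enum_val i) v)%:R =
    \sum_(w | adj v w) x w.
  rewrite -(big_enum_val (A := predT) (fun w => x w * (adj w v)%:R)) /=.
  rewrite big_mkcond [RHS]big_mkcond /=; apply: eq_bigr => w _.
  by rewrite adj_sym; case: (adj v w); rewrite ?mulr1 ?mulr0.
split=> [/eigenvalueP[y yA y0]|[x [[v xv0] xA]]].
  exists (fun v => y 0 (enum_rank v)); split.
    have /rV0Pn[i yi0] := y0.
    by exists (enum_val i); rewrite enum_valK.
  move=> v; rewrite -mulE; have /rowP/(_ (enum_rank v)) := yA.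
  rewrite !mxE => <-; apply: eq_bigr => i _.
  by rewrite enum_valK mxE enum_rankK.
apply/eigenvalueP; exists (\row_i x (enum_val i)).
  apply/rowP => j; rewrite !mxE -xA -mulE.
  by apply: eq_bigr => i _; rewrite !mxE.
by apply/rV0Pn; exists (enum_rank v); rewrite mxE enum_rankK.
Qed.

(** The eigenvalues are bounded: comparing absolute values in the eigenvalue
    equation at an entry of largest absolute value gives [b <= #|G|]. *)
Lemma eigenvalue_le_spectral_radius (R : realType) (G : sgraph) (a : R) :
  eigenvalue (adjacency_matrix R G) a -> a <= spectral_radius R G.
Proof.
move=> eig_a; apply: ub_le_sup => //; exists #|G|%:R => b.
move=> /eigenvalue_adjacencyP[x [[v xv0] xA]].
case: (@Order.TotalTheory.arg_maxP _ _ _ v predT (fun w => `|x w|))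
  => // u _ maxu.
have xu0 : 0 < `|x u| by apply: lt_le_trans (maxu v isT); rewrite normr_gt0.
apply: le_trans (ler_norm b) _; rewrite -(ler_pM2r xu0) -normrM -xA.
apply: le_trans (ler_norm_sum _ _ _) _.
apply: le_trans (ler_sum _ (fun w _ => maxu w isT)) _.
rewrite sumr_const -[leLHS]mulr_natl ler_wpM2r // ler_nat.
exact: max_card.
Qed.

(** When the supremum is not that of a nonempty bounded set it is 0 by
    convention, so a nonnegative number below it always has an eigenvalue above
    it. *)
Lemma eigenvalue_near_spectral_radius (R : realType) (G : sgraph) (b : R) :
  0 <= b -> b < spectral_radius R G ->
  exists a, eigenvalue (adjacency_matrix R G) a /\ b < a.
Proof.
move=> b0; rewrite /spectral_radius => ltb; set E := [set a | _]%classic in ltb.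
have [E0|E0] := pselect (E !=set0)%classic.
  by have [a eig_a lta] := sup_gt E0 ltb; exists a.
move: ltb; rewrite sup_out ?ltNge ?b0 //.
by case.
Qed.

(** The eigenvector takes the value [t] on the clique and [k] on the independent
    set; the hypothesis on [t] is the eigenvalue equation on the clique. *)
Lemma S_graph_eigenvalue (R : realType) (n k : nat) (t : R) :
  (0 < k)%N -> t != 0 -> t ^+ 2 = k.-1%:R * t + k%:R * (n - k)%:R ->
  eigenvalue (adjacency_matrix R (S_graph n k)) t.
Proof.
move=> k0 t0 tE; apply/eigenvalue_adjacencyP.
exists (fun v : S_graph n k => if v is inl _ then t else k%:R); split.
  by exists (inl (Ordinal k0)).
case=> i; rewrite big_sumType /=.
  rewrite (eq_bigl (predC1 i)) => [|j]; last by rewrite /= /complete_adj eq_sym.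
  rewrite !sumr_const cardC1 !card_ord -expr2 tE.
  by rewrite -[t *+ _]mulr_natl -[k%:R *+ _]mulr_natr.
rewrite [X in _ + X]big_pred0 => [|j]; last first.
  by rewrite /compl_adj /complete_adj andbN.
by rewrite addr0 sumr_const card_ord mulr_natr.
Qed.

(** Passing from suprema to an eigenvalue of [G] loses a little.  The spectral radius [t] of [S_graph n k] satisfies
    [t ^ 2 = (k - 1) * t + k * (n - k)], and [k >= 2] leaves enough room above
    [k * (n - k)] to accept any eigenvalue of [G] exceeding [t - 1/2]. *)
Lemma large_eigenvector (R : realType) (n k : nat) (G : sgraph) :
  (2 <= k)%N -> (k < n)%N ->
  spectral_radius R (S_graph n k) <= spectral_radius R G ->
  exists (a : R) (x : G -> R),
  [/\ 0 <= a, (k * (n - k))%:R <= a ^+ 2, exists v, 0 < x v &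
      forall v, \sum_(w | adj v w) x w = a * x v].
Proof.
move=> k2 kn leSG.
pose p : R := k.-1%:R; pose q : R := (k * (n - k))%:R.
pose t : R := (p + Num.sqrt (p ^+ 2 + 4 * q)) / 2.
have p1 : 1 <= p by rewrite ler1n; lia.
have q1 : 1 <= q by rewrite ler1n muln_gt0 subn_gt0 kn; lia.
set s := Num.sqrt _ in t *.
have s0 : 0 <= s by exact: sqrtr_ge0.
have sE : s ^+ 2 = p ^+ 2 + 4 * q by rewrite sqr_sqrtr //; nra.
have s2 : 2 <= s by nra.
have tE : t ^+ 2 = p * t + q by rewrite /t; nra.
have t1 : 3 / 2 <= t by rewrite /t; nra.
have [||a [eig_a lta]] := @eigenvalue_near_spectral_radius R G (t - 2^-1).
- by lra.
- apply: (@lt_le_trans _ _ t); first by lra.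
  apply: le_trans leSG; apply: eigenvalue_le_spectral_radius.
  apply: S_graph_eigenvalue; [by lia|by lra|].
  by rewrite tE -natrM.
have [x [[v xv0] xA]] := (eigenvalue_adjacencyP G a).1 eig_a.
have a0 : 0 <= a by lra.
(* Multiplying by [x v] makes the entry at [v] positive. *)
exists a, (fun w => x v * x w); split=> //.
- by rewrite -/q; nra.
- by exists v; rewrite -expr2 exprn_even_gt0.
- by move=> w; rewrite -mulr_sumr xA mulrCA.
Qed.

(** * From a large eigenvalue to a complete bipartite subgraph *)

Lemma sparse_degree_sum (C : nat) (G : sgraph) (X : {set G}) :
  sparse C G -> (\sum_(v in X) #|nbhd v| <= C * #|G|)%N.
Proof.
move=> /(_ setT); rewrite cardsT; apply: leq_trans.
rewrite [leqRHS](big_setID X) /= setTI; apply: leq_trans (leq_addr _ _).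
by apply: leq_sum => v _; rewrite setIT.
Qed.

(** A vertex with at least [k] neighbours in [T] is joined to all of some
    [k]-subset of [T], and there are at most [2 ^ #|T|] such subsets. *)
Lemma few_rich_vertices (G : sgraph) (T : {set G}) (k m : nat) :
  (forall A : {set G}, #|A| = k -> (#|[set v | A \subset nbhd v]| <= m)%N) ->
  (#|[set v | k <= #|nbhd v :&: T|]| <= 2 ^ #|T| * m)%N.
Proof.
move=> noB; rewrite -card_powerset -sum_nat_const.
apply: (@leq_trans (\sum_(A in powerset T | #|A| == k)
  #|[set v | A \subset nbhd v]|)).
  under eq_bigr => A _ do rewrite -sum1_card big_mkcond /=.
  rewrite exchange_big /= -sum1_card big_mkcond /=; apply: leq_sum => v _.
  rewrite inE; case: ifP => // /card_geqP[s [us ss sub]].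
  have sE : #|[set y in s]| == k by rewrite cardsE -ss; apply/eqP/card_uniqP.
  rewrite (bigD1 [set y in s]) /=.
    rewrite inE ifT //; apply/subsetP => y; rewrite inE => /sub.
    by rewrite in_setI => /andP[].
  rewrite sE andbT inE; apply/subsetP => y; rewrite inE => /sub.
  by rewrite in_setI => /andP[].
rewrite big_mkcondr /=; apply: leq_sum => A _; case: eqP => // /noB.
by [].
Qed.

Lemma nbhd_sum_le (G : sgraph) (X T : {set G}) (k : nat) :
  (\sum_(v in X) #|nbhd v :&: T| <=
     k.-1 * #|X| + #|T| * #|[set v | k <= #|nbhd v :&: T|]|)%N.
Proof.
set Q := [set v | _].
apply: (@leq_trans (\sum_(v in X) (k.-1 + #|T| * (v \in Q)))).
  apply: leq_sum => v _; rewrite inE; have [h|h] := leqP k #|nbhd v :&: T|.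
    rewrite muln1; apply: leq_trans (leq_addl _ _).
    by rewrite subset_leq_card ?subsetIr.
  by rewrite muln0 addn0; lia.
rewrite big_split /= sum_nat_const mulnC leq_add2l -big_distrr /=.
apply: leq_mul => //; rewrite -sum1_card.
rewrite [leqRHS]big_mkcond [leqLHS]big_mkcond /=.
apply: leq_sum => v _.
by case: (v \in X); case: (v \in Q).
Qed.

Lemma nbhd_weight_le_degree (R : realType) (G : sgraph) (x : G -> R) (v : G) :
  (forall w, x w <= 1) -> \sum_(w | adj v w) x w <= #|nbhd v|%:R.
Proof.
move=> x1; apply: le_trans (ler_sum _ (fun w _ => x1 w)) _.
rewrite sumr_const ler_nat; apply: eq_leq.
by apply: eq_card => w; rewrite !inE.
Qed.

Lemma nbhd_weight_split (R : realType) (G : sgraph) (x : G -> R) (v : G)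
    (eta : R) :
  (forall w, x w <= 1) -> 0 <= eta ->
  \sum_(w | adj v w) x w <=
    #|nbhd v :&: [set w | eta <= x w]|%:R + eta * #|nbhd v|%:R.
Proof.
move=> x1 eta0.
have cardE (A : {set G}) : #|A|%:R = \sum_(w in A) 1 :> R.
  by rewrite sumr_const.
rewrite !cardE mulr_sumr mulr1 [leLHS]big_mkcond.
rewrite [X in X + _]big_mkcond [X in _ + X]big_mkcond -big_split /=.
apply: ler_sum => w _; rewrite !inE; case: (adj v w) => /=; last by rewrite addr0.
have [h|h] := leP eta (x w); first by have := x1 w; lra.
by rewrite add0r ltW.
Qed.

(** Count the walks of length 2 from [v], weighted by the eigenvector at their
    ends: ends of weight less than [eta] contribute little because the graph has
    linearly many edges, the others contribute at most 1 each. *)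
Lemma two_step_weight_le (R : realType) (G : sgraph) (x : G -> R) (C : nat)
    (a eta : R) (v : G) :
  (forall w, x w <= 1) -> sparse C G -> 0 <= eta ->
  (forall w, \sum_(y | adj w y) x y = a * x w) ->
  a ^+ 2 * x v <=
    (\sum_(w in nbhd v) #|nbhd w :&: [set y | (eta <= x y)%R]|)%:R
    + eta * (C * #|G|)%:R.
Proof.
move=> x1 spG eta0 ax; rewrite expr2 -mulrA -ax mulr_sumr.
rewrite (eq_bigr _ (fun w _ => esym (ax w))).
apply: le_trans (ler_sum _ (fun w _ => nbhd_weight_split w x1 eta0)) _.
rewrite big_split /= -mulr_sumr -!natr_sum.
have nbE (F : G -> nat) : (\sum_(w | adj v w) F w = \sum_(w in nbhd v) F w)%N.
  by apply: eq_bigl => w; rewrite inE.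
by rewrite !nbE lerD2l ler_wpM2l // ler_nat sparse_degree_sum.
Qed.

(** Scale the eigenvector to have largest entry 1, at [u].  A vertex of weight at
    least [1 / (2 * C)] has degree at least [n / (6 * C ^ 2)], so the set [T] of
    such vertices has bounded size.  Walks of length 2 from [u] with end outside
    [T] weigh at most [n / 2], so the at most [n] neighbours of [u] send at least
    [(k - 1/2) * n - k ^ 2] edges to [T].  Hence a number of vertices linear in
    [n] have [k] neighbours in [T], and many of them share the same [k]. *)
Lemma sparse_eigenvector_biclique (R : realType) (k C m : nat) (G : sgraph)
    (a : R) (x : G -> R) :
  (2 <= k)%N -> (0 < C)%N -> sparse C G ->
  ((36 * C ^ 5) ^ 2 + 2 * k ^ 2 + 2 * (6 * C ^ 3 * (2 ^ (6 * C ^ 3) * m))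
     < #|G|)%N ->
  0 <= a -> (k * (#|G| - k))%:R <= a ^+ 2 ->
  (exists v, 0 < x v) -> (forall v, \sum_(w | adj v w) x w = a * x v) ->
  exists A B : {set G},
    [/\ {in A & B, forall v w, adj v w}, #|A| = k & (m <= #|B|)%N].
Proof.
move=> k2 C0 spG largeG a0 a2 [v0 xv0] ax.
pose n := #|G|; pose c : R := C%:R; pose N : R := n%:R.
have c1 : 1 <= c by rewrite ler1n.
have Na2 : N <= a ^+ 2.
  have nk : (2 * k ^ 2 < n)%N.
    by apply: leq_ltn_trans largeG; rewrite -addnA addnCA leq_addr.
  apply: le_trans a2; rewrite ler_nat -/n.
  by move: nk; rewrite expnS expn1 => nk; clear -k2 nk; nia.
(* With this bound the vertices of weight at least [1 / (6 * C ^ 2)] number at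
   most [n / (6 * C ^ 2)]. *)
have aM : 36 * c ^+ 5 <= a.
  have c5 : 0 <= 36 * c ^+ 5 by rewrite mulr_ge0 // exprn_ge0 //; lra.
  rewrite -(@ler_pXn2r _ 2) ?nnegrE //; apply: le_trans Na2.
  rewrite /c /N -natrX -natrM -natrX ler_nat ltnW //.
  by apply: leq_ltn_trans largeG; rewrite -addnA leq_addr.
case: (@Order.TotalTheory.arg_maxP _ _ _ v0 predT x) => // u _ maxu.
have xu0 : 0 < x u by apply: lt_le_trans (maxu v0 isT).
pose y v := x v / x u.
have y1 v : y v <= 1 by rewrite ler_pdivrMr // mul1r; apply: maxu.
have yu : y u = 1 by rewrite /y divff // gt_eqF.
have ay v : \sum_(w | adj v w) y w = a * y v.
  by rewrite -mulr_suml ax mulrA.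
pose e := c^-1; have ce : c * e = 1 by rewrite mulfV // gt_eqF //; lra.
have e0 : 0 < e by rewrite invr_gt0; lra.
(* Two thresholds: [eta = 1 / (6 * C ^ 2)] serves only to show that vertices of
   weight at least [1 / (2 * C)] have linear degree.  At level [eta] the degree
   is merely known to be at least [a * eta], which is large but may be of order
   [sqrt n]; this bounds [L] by a small multiple of [n]. *)
pose eta := e ^+ 2 / 6.
have eta0 : 0 <= eta by rewrite /eta; nra.
pose L := [set w | eta <= y w].
have degsum (X : {set G}) : \sum_(v in X) (#|nbhd v|%:R : R) <= c * N.
  by rewrite -natr_sum -natrM ler_nat sparse_degree_sum.
have cardL : #|L|%:R * (a * eta) <= c * N.
  apply: le_trans (degsum L).
  rewrite mulr_natl -sumr_const; apply: ler_sum => w.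
  rewrite inE => ew; apply: le_trans (nbhd_weight_le_degree w y1).
  by rewrite ay ler_wpM2l.
have cL : c * #|L|%:R <= N * e / 6.
  have le1 : #|L|%:R * (36 * c ^+ 5 * eta) <= c * N.
    by apply: le_trans cardL; apply: ler_wpM2l => //; apply: ler_wpM2r.
  have := ler_wpM2r (exprn_ge0 2 (ltW e0)) le1; rewrite /eta.
  have -> : #|L|%:R * (36 * c ^+ 5 * (e ^+ 2 / 6)) * e ^+ 2 =
            6 * (c * e) ^+ 4 * (c * #|L|%:R) :> R by field.
  have -> : c * N * e ^+ 2 = c * e * (N * e) by ring.
  rewrite ce expr1n; lra.
have degT w : e / 2 <= y w -> N <= 6 * c ^+ 2 * #|nbhd w|%:R.
  move=> ew.
  have : a ^+ 2 * y w <= c * (#|nbhd w|%:R + #|L|%:R) + eta * (c * N).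
    apply: le_trans (two_step_weight_le w y1 spG eta0 ay) _.
    by rewrite natrM lerD2r -natrD -natrM ler_nat sparse_between.
  have -> : eta * (c * N) = c * e * (N * e / 6) by rewrite /eta; field.
  rewrite ce mul1r mulrDr => le1.
  have le2 : N * (e / 2) <= a ^+ 2 * y w.
    by rewrite ler_pM // ?ler0n // ltW // divr_gt0.
  have le3 : N * e / 6 <= c * #|nbhd w|%:R by lra.
  have c6 : 0 <= 6 * c by lra.
  have := ler_wpM2l c6 le3.
  have -> : 6 * c * (N * e / 6) = c * e * N by field.
  by rewrite ce mul1r expr2 !mulrA.
pose T := [set w | e / 2 <= y w].
have N0 : 0 < N by rewrite ltr0n (leq_ltn_trans _ largeG).
have cardT : (#|T| <= 6 * C ^ 3)%N.
  rewrite -(ler_nat R) natrM natrX -/c -(ler_pM2r N0) mulr_natl -sumr_const.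
  apply: (@le_trans _ _ (\sum_(w in T) 6 * c ^+ 2 * #|nbhd w|%:R)).
    by apply: ler_sum => w; rewrite inE => /degT.
  rewrite -mulr_sumr [leRHS](_ : _ = 6 * c ^+ 2 * (c * N)); last by ring.
  by rewrite ler_wpM2l // mulr_ge0 // exprn_ge0 //; lra.
have e2 : 0 <= e / 2 by lra.
have walku : a ^+ 2 <= (\sum_(w in nbhd u) #|nbhd w :&: T|)%:R + N / 2.
  have := two_step_weight_le u y1 spG e2 ay.
  rewrite yu mulr1 natrM -/c -/N.
  have -> : e / 2 * (c * N) = c * e * (N / 2) by field.
  by rewrite ce mul1r.
have [[A [cardA mA]]|noA] := pselect (exists A : {set G},
    #|A| = k /\ (m <= #|[set v | A \subset nbhd v]|)%N).
  exists A, [set v | A \subset nbhd v]; split=> // v w vA.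
  by rewrite inE => /subsetP/(_ v vA); rewrite inE adj_sym.
exfalso.
have few : (#|[set v | k <= #|nbhd v :&: T|]| <= 2 ^ #|T| * m)%N.
  apply: few_rich_vertices => A cardA; rewrite leqNgt; apply/negP => ltm.
  by apply: noA; exists A; rewrite ltnW.
have sum_le : (\sum_(w in nbhd u) #|nbhd w :&: T| <=
    k.-1 * n + 6 * C ^ 3 * (2 ^ (6 * C ^ 3) * m))%N.
  apply: leq_trans (nbhd_sum_le _ _ k) _; rewrite leq_add //.
    by rewrite leq_mul2l max_card orbT.
  rewrite leq_mul // (leq_trans few) // leq_mul2r leq_exp2l // cardT.
  by rewrite orbT.
have walk_nat : (2 * (k * (n - k)) <=
    2 * \sum_(w in nbhd u) #|nbhd w :&: T| + n)%N.
  rewrite -(ler_nat R) natrD !(natrM _ 2) -/N.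
  by have := le_trans a2 walku; rewrite -/n; lra.
have : (2 * k ^ 2 + 2 * (6 * C ^ 3 * (2 ^ (6 * C ^ 3) * m)) < n)%N.
  by apply: leq_ltn_trans largeG; rewrite -addnA leq_addl.
move: walk_nat sum_le; move: (\sum_(w in _) _)%N (6 * _ * _)%N => W Z.
rewrite expnS expn1; move: (n) k2; case: (k) => // k' n' _ /=; clear; nia.
Qed.

Local Close Scope ring_scope.

(** * Spiders in graphs of large spectral radius *)

Theorem theorem1p3 (R : realType) (k : nat) (S : sgraph) (c : S) (r s : nat) :
  2 <= k ->
  spider S -> spider_center c -> #|S| = 2 * k + 3 ->
  num_odd_legs c = r -> num_unit_legs c = s ->
  3 <= r -> 2 <= 2 * s - r ->
  exists n0 : nat, forall n : nat, n0 <= n ->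
    forall G : sgraph, #|G| = n ->
      (spectral_radius R (S_graph n k) <= spectral_radius R G)%R ->
      contains_subgraph G S.
Proof.
move=> k2 spiderS centerc cardS oddE _ r3 _.
have [E [bipE leE]] := spider_even_class spiderS centerc.
have treeS := spiderS.1.
pose C := 2 * #|S|; pose m := #|S|.
exists ((36 * C ^ 5) ^ 2 + 2 * k ^ 2
  + 2 * (6 * C ^ 3 * (2 ^ (6 * C ^ 3) * m))).+1.
move=> n ltn G cardG leSG; have [//|freeS] := pselect (contains_subgraph G S).
have spG : sparse C G := tree_free_sparse treeS freeS.
have kn : k < n.
  apply: leq_ltn_trans ltn; rewrite addnAC; apply: leq_trans (leq_addl _ _).
  by clear -k2; rewrite expnS expn1; nia.
have [a [x [a0 a2 xpos ax]]] := large_eigenvector k2 kn leSG.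
subst n.
have [|A [B [adjAB cardA leB]]] :=
  sparse_eigenvector_biclique k2 _ spG ltn a0 a2 xpos ax.
  by rewrite /C cardS; lia.
apply: (bipartite_in_biclique bipE adjAB); rewrite ?cardA.
- by rewrite cardS oddE in leE; lia.
- by apply: leq_trans (max_card _) leB.
- by apply: leq_trans leB; rewrite /m cardS; lia.
Qed.
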